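(* Fix $k\ge3$ and put $q=k-2$. For each $\nu=1,\ldots,q$, let $N_\nu$ be a Hadamard order and let $r_\nu$ be a positive integer with $r_\nu\le\rho(N_\nu)$. If $N=N_1\cdots N_q$ and $1\le m\le N$, then $$\Lambda_k(r_1,\ldots,r_q,m,N)=\sqrt N.$$
   Context: $\Lambda_k(d_1,\ldots,d_k)$ denotes the minimum, over all arrays $(\varepsilon_{i_1\cdots i_k})\in\{-1,1\}^{d_1\times\cdots\times d_k}$, of the norm $\sup\{|A(x^{(1)},\ldots,x^{(k)})|:\|x^{(j)}\|_2\le1\}$ of the real $k$-linear form $A(x^{(1)},\ldots,x^{(k)})=\sum\varepsilon_{i_1\cdots i_k}x^{(1)}_{i_1}\cdots x^{(k)}_{i_k}$ on $\mathbb{R}^{d_1}\times\cdots\times\mathbb{R}^{d_k}$ with Euclidean norms. A Hadamard order is a positive integer $n$ for which there exists a Hadamard matrix of order $n$, i.e. $H\in\{-1,1\}^{n\times n}$ with $HH^T=nI_n$. The Hurwitz--Radon function $\rho$ is defined by writing uniquely $n=2^{4a+b}u$ with $u$ odd, $a\ge0$ an integer, $0\le b\le3$, and setting $\rho(n)=8a+2^b$. *)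

(* Defs.v *)
From mathcomp Require Import all_boot all_order all_algebra.
From mathcomp Require Import all_classical all_reals.
Set Implicit Arguments.
Unset Strict Implicit.
Unset Printing Implicit Defensive.
Import Order.TTheory GRing.Theory Num.Theory.
Local Open Scope classical_set_scope.
Local Open Scope ring_scope.

Section MultilinearForms.
Variables (R : realType) (k : nat) (d : 'I_k -> nat).

Definition multi_index := {dffun forall j : 'I_k, 'I_(d j)}.

(* [false] encodes the sign 1 and [true] the sign -1, so that the arrays
   form a finite type and the minimum in [Lambda] is one over a finite type. *)
Definition sign_array := {ffun multi_index -> bool}.

Definition entry (e : sign_array) (i : multi_index) : R := (-1) ^+ (e i).

Definition euclidean_norm n (x : 'rV[R]_n) : R :=
  Num.sqrt (\sum_(i < n) x 0 i ^+ 2).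

Definition sign_form (e : sign_array) (x : forall j : 'I_k, 'rV[R]_(d j)) : R :=
  \sum_(i : multi_index) entry e i * \prod_(j < k) x j 0 (i j).

Definition form_norm (e : sign_array) : R :=
  sup [set `|sign_form e x| | x in
        [set x : forall j : 'I_k, 'rV[R]_(d j) |
          forall j, euclidean_norm (x j) <= 1]].

(* The default array [ffun=> false] is only the starting point of the
   minimization; see [Lambda_minimum]. *)
Definition Lambda : R :=
  form_norm [arg min_(e < ([ffun=> false] : sign_array)) form_norm e]%O.

Lemma Lambda_minimum :
  (exists e, Lambda = form_norm e) /\ (forall e, Lambda <= form_norm e).
Proof.
rewrite /Lambda; case: arg_minP => // e _ He.
by split=> [|e']; [exists e | exact: He].
Qed.

End MultilinearForms.

Definition hadamard_matrix n (H : 'M[int]_n) : Prop :=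
  (forall i j, H i j = 1 \/ H i j = -1) /\ H *m H^T = n%:R%:M.

Definition hadamard_order (n : nat) : Prop :=
  (0 < n)%N /\ exists H : 'M[int]_n, hadamard_matrix H.

Definition hurwitz_radon (n : nat) : nat :=
  (8 * (logn 2 n %/ 4) + 2 ^ (logn 2 n %% 4))%N.

Lemma hurwitz_radonE (a b u : nat) : odd u -> (b <= 3)%N ->
  hurwitz_radon (2 ^ (4 * a + b) * u) = (8 * a + 2 ^ b)%N.
Proof.
move=> ou b3; have u0 : (0 < u)%N by case: u ou.
have E : logn 2 (2 ^ (4 * a + b) * u) = (4 * a + b)%N.
  rewrite lognM ?expn_gt0 // pfactorK // [X in (_ + X)%N](_ : _ = 0)%N ?addn0 //.
  by rewrite lognE dvdn2 ou /= andbF.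
by rewrite /hurwitz_radon E [(4 * a)%N]mulnC divnMDl // modnMDl divn_small // modn_small // addn0.
Qed.

(* The tuple (r_1, ..., r_q, m, n), meant for k = q + 2. *)
Definition dims_cat2 (k q : nat) (r : 'I_q -> nat) (m n : nat) : 'I_k -> nat :=
  fun j => nth 0%N (codom r ++ [:: m; n]) j.

(* Main.v *)
Require Import Defs.
From mathcomp Require Import all_boot all_order all_algebra.
From mathcomp Require Import all_classical all_reals.
From mathcomp Require Import ring lra.
Set Implicit Arguments.
Unset Strict Implicit.
Unset Printing Implicit Defensive.
Import Order.TTheory GRing.Theory Num.Theory.
Local Open Scope ring_scope.

(** The lower bound holds for every array: freezing every variable but the last
    at a basis vector leaves a linear form on the last space whose
    coefficients are signs, and such a form has norm the square root of the
    dimension ([sqrt_dim_le_form_norm]).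

    The upper bound needs one good array.  Suppose that for every [v] there are
    sign matrices [A_l], [l < r v], of order [N v] such that
    [M c = \sum_l c_l A_l] satisfies [M c (M c)^T = N_v |c|^2 I] for all real
    [c] ([hurwitz_radon_hadamard]).  The Kronecker product [T] over [v] of the
    matrices [M (x v)] then satisfies
    [T T^T = (\prod_v N v) (\prod_v |x v|^2) I] ([tensor_orthogonal]), so
    the form [y T z^T], in which [y] ranges over the vectors supported on the
    first [m] rows, is bounded by [sqrt (\prod_v N v)] on the product of the
    unit balls, by Cauchy-Schwarz.  The coefficients of this form in the
    coordinates of [x], [y] and [z] are products of entries of the [A_l], hence
    signs ([form_norm_le_sqrt]).

    The matrices [A_l] come from a Hadamard matrix [H] of order [n] by putting
    [A_l = U_l H], where the [U_l] are signed permutation matrices, so that the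
    entries remain signs.  What is required is that [U_0 = I] and that the other
    [U_l] square to [-I] and anticommute pairwise; the orthogonality then
    follows from [U_l U_l'^T + U_l' U_l^T = 0] for distinct [l] and [l']
    ([hurwitz_sum_of_squares]).  A family of [hurwitz_radon n - 1] such
    matrices is built from tensor products of real Pauli matrices: there are
    1, 3 and 7 of them in orders 2, 4 and 8, and in order 16 there are 8
    together with a symmetric involution [w] that anticommutes with all of
    them.  Given a family [G] in order [n], the 8 matrices [g (x) 1] and the
    matrices [w (x) h], [h] in [G], form a family in order [16 n]; this is the
    period-8 law behind the Hurwitz-Radon function ([radon_family_tensor]). *)

(** * Families of anticommuting signed permutations *)

(** The monomial matrix whose row [a] has its only nonzero entry, of sign
    [(g a).1], in column [(g a).2].  Maps over arbitrary finite types, rather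
    than matrices, make tensor products and changes of index set immediate.
    Signs are booleans, with [true] for -1. *)
Definition signed_map (T : Type) := T -> bool * T.

Definition signed_id (T : Type) : signed_map T := fun a => (false, a).

Definition signed_comp (T : Type) (g h : signed_map T) : signed_map T :=
  fun a => ((h a).1 (+) (g (h a).2).1, (g (h a).2).2).

Definition signed_tensor (S T : Type) (g : signed_map S) (h : signed_map T) :
    signed_map (S * T) :=
  fun a => ((g a.1).1 (+) (h a.2).1, ((g a.1).2, (h a.2).2)).

(** The signs of squares and of commutations are parameters because both
    multiply under tensor products; they determine which products again satisfy
    the relations required of a Radon family. *)
Definition square_sign (T : finType) (e : bool) (g : signed_map T) : bool :=
  [forall a, signed_comp g g a == (e, a)].

Definition commutation_sign (T : finType) (e : bool) (g h : signed_map T) :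
    bool :=
  [forall a, signed_comp g h a
             == (e (+) (signed_comp h g a).1, (signed_comp h g a).2)].

Definition radon_family (T : finType) (G : seq (signed_map T)) : bool :=
  all (square_sign true) G && pairwise (commutation_sign true) G.

Lemma square_sign_tensor (S T : finType) (e f : bool)
    (g : signed_map S) (h : signed_map T) :
  square_sign e g -> square_sign f h ->
  square_sign (e (+) f) (signed_tensor g h).
Proof.
move=> /forallP sg /forallP sh; apply/forallP=> -[a b].
move: (sg a) (sh b); rewrite /signed_comp /signed_tensor /=.
by move=> /eqP[E1 ->] /eqP[E2 ->]; rewrite addbACA E1 E2.
Qed.

Lemma commutation_sign_tensor (S T : finType) (e f : bool)
    (g g' : signed_map S) (h h' : signed_map T) :
  commutation_sign e g g' -> commutation_sign f h h' ->
  commutation_sign (e (+) f) (signed_tensor g h) (signed_tensor g' h').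
Proof.
move=> /forallP sg /forallP sh; apply/forallP=> -[a b].
move: (sg a) (sh b); rewrite /signed_comp /signed_tensor /=.
move=> /eqP[E1 ->] /eqP[E2 ->]; apply/eqP; congr (_, _).
by rewrite addbACA E1 E2 [LHS]addbACA; congr addb; rewrite addbACA.
Qed.

Lemma square_sign_id (T : finType) : square_sign false (@signed_id T).
Proof. exact/forallP. Qed.

Lemma commutation_sign_refl (T : finType) (g : signed_map T) :
  commutation_sign false g g.
Proof. by apply/forallP=> a; rewrite addFb -surjective_pairing. Qed.

Lemma commutation_sign_id (T : finType) (g : signed_map T) :
  commutation_sign false (@signed_id T) g.
Proof. by apply/forallP=> a; rewrite /signed_comp /= addbF. Qed.

Lemma radon_family_tensor_id (S T : finType) (G : seq (signed_map S)) :
  radon_family G -> radon_family [seq signed_tensor g (@signed_id T) | g <- G].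
Proof.
case/andP=> sG cG; rewrite /radon_family all_map pairwise_map; apply/andP; split.
  apply: sub_all sG => g sg.
  exact: (square_sign_tensor sg (square_sign_id T)).
apply: sub_pairwise cG => g h cgh.
exact: (commutation_sign_tensor cgh (commutation_sign_refl _)).
Qed.

(** The step of the period-8 recursion.  The grading element [w] makes the two
    halves anticommute with each other, and being an involution it does not
    change the squares of the second half. *)
Lemma radon_family_tensor (S T : finType) (w : signed_map S)
    (G : seq (signed_map S)) (H : seq (signed_map T)) :
  radon_family G -> square_sign false w ->
  all (commutation_sign true ^~ w) G -> radon_family H ->
  radon_family ([seq signed_tensor g (@signed_id T) | g <- G]
                ++ [seq signed_tensor w h | h <- H]).
Proof.
move=> rG sw cw /andP[sH cH].
case/andP: (radon_family_tensor_id T rG) => sG' cG'.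
rewrite /radon_family all_cat pairwise_cat sG' cG' all_map pairwise_map andTb.
apply/and3P; split.
- by apply: sub_all sH => h sh; apply: (square_sign_tensor sw sh).
- rewrite allrel_mapl allrel_mapr; apply: sub_all cw => g cgw.
  apply: sub_all sH => h _.
  exact: (commutation_sign_tensor cgw (commutation_sign_id h)).
- apply: sub_pairwise cH => h h' chh'.
  exact: (commutation_sign_tensor (commutation_sign_refl w) chh').
Qed.

(** Matrices need the index set ['I_n]; the relations between signed maps do
    not depend on how their points are numbered. *)
Lemma radon_family_relabel (T : finType) (G : seq (signed_map T)) :
  radon_family G ->
  radon_family
    [seq (fun i => ((g (enum_val i)).1, enum_rank (g (enum_val i)).2))
         : signed_map 'I_#|T| | g <- G].
Proof.
case/andP=> sG cG; rewrite /radon_family all_map pairwise_map; apply/andP; split.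
  apply: sub_all sG => g /forallP sg; apply/forallP=> i /=.
  by move: (sg (enum_val i)); rewrite /signed_comp /= enum_rankK => /eqP[-> ->];
     rewrite enum_valK.
apply: sub_pairwise cG => g h /forallP cgh; apply/forallP=> i /=.
move: (cgh (enum_val i)); rewrite /signed_comp /= !enum_rankK.
by move=> /eqP[-> ->].
Qed.

(** The real Pauli matrices; [pauliY] is the product of the other two.  Any two
    distinct ones among X, Y and Z anticommute, and only Y is skew.  So a tensor
    product of Pauli matrices is skew when it has an odd number of factors Y,
    and two such products anticommute when they disagree, off the identity
    factors, in an odd number of places. *)
Definition pauliX : signed_map bool := fun a => (false, ~~ a).
Definition pauliZ : signed_map bool := fun a => (a, a).
Definition pauliY : signed_map bool := fun a => (a, ~~ a).
Local Notation pauliI := (@signed_id bool).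
Local Notation "g *s h" := (signed_tensor g h) (at level 40, left associativity).

Lemma radon_family1 : radon_family [:: pauliY].
Proof. by apply/andP; split=> //=; rewrite andbT; apply/forallP=> -[]. Qed.

Lemma radon_family2 :
  radon_family [:: pauliI *s pauliY; pauliY *s pauliX; pauliY *s pauliZ].
Proof.
by apply/andP; split; rewrite /= ?andbT; do ![apply/andP; split];
  apply/forallP=> -[[] []].
Qed.

(** In order 4 the triples [1 Y], [Y X], [Y Z] and [Y 1], [X Y], [Z Y] are the
    left and right multiplications by the imaginary quaternions, and they
    commute with each other.  Tensoring the first by X and the second by Z, and
    adding [Y 1 1], gives the seven matrices of order 8. *)
Definition pauli_family3 : seq (signed_map (bool * bool * bool)) :=
  [:: pauliX *s pauliI *s pauliY; pauliX *s pauliY *s pauliX;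
      pauliX *s pauliY *s pauliZ; pauliZ *s pauliY *s pauliI;
      pauliZ *s pauliX *s pauliY; pauliZ *s pauliZ *s pauliY;
      pauliY *s pauliI *s pauliI].

Lemma radon_family3 : radon_family pauli_family3.
Proof.
by apply/andP; split; rewrite /= ?andbT; do ![apply/andP; split];
  apply/forallP=> -[[[] []] []].
Qed.

Definition pauli_family4 : seq (signed_map (bool * (bool * bool * bool))) :=
  [seq pauliX *s g | g <- pauli_family3] ++ [:: pauliY *s @signed_id _].

Lemma radon_family4 : radon_family pauli_family4.
Proof.
by apply/andP; split; rewrite /= ?andbT; do ![apply/andP; split];
  apply/forallP=> -[[] [[[] []] []]].
Qed.

(** [Z 1 1 1] anticommutes with the leading factors X and Y of all the members;
    it is the grading element used in the recursion. *)
Lemma radon_family4_grading :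
  all (commutation_sign true ^~ (pauliZ *s @signed_id (bool * bool * bool)))
      pauli_family4.
Proof.
by rewrite /= ?andbT; do ![apply/andP; split];
  apply/forallP=> -[[] [[[] []] []]].
Qed.

Lemma square_sign_grading :
  square_sign false (pauliZ *s @signed_id (bool * bool * bool)).
Proof. by apply/forallP=> -[[] b]. Qed.

Lemma radon_family_ord (T : finType) (G : seq (signed_map T)) (n : nat) :
  #|T| = n -> radon_family G ->
  exists2 G' : seq (signed_map 'I_n), size G' = size G & radon_family G'.
Proof.
move=> <- /radon_family_relabel rG; eexists; last exact: rG.
by rewrite size_map.
Qed.

(** There are [2 ^ b - 1] matrices here and not [2 ^ b]: the identity, which
    completes the family to the Hurwitz-Radon number, is added at the end. *)
Lemma radon_family_base (b u : nat) : (b <= 3)%N ->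
  exists2 G : seq (signed_map 'I_(2 ^ b * u)),
    size G = (2 ^ b).-1 & radon_family G.
Proof.
case: b => [|[|[|[|//]]]] _.
- by exists [::].
- have /radon_family_ord := radon_family_tensor_id 'I_u radon_family1.
  by apply; rewrite !card_prod card_bool card_ord.
- have /radon_family_ord := radon_family_tensor_id 'I_u radon_family2.
  by apply; rewrite !card_prod card_bool card_ord.
- have /radon_family_ord := radon_family_tensor_id 'I_u radon_family3.
  by apply; rewrite !card_prod card_bool card_ord.
Qed.

Lemma radon_family_exists (a b u : nat) : (b <= 3)%N ->
  exists2 G : seq (signed_map 'I_(2 ^ (4 * a + b) * u)),
    (size G).+1 = (8 * a + 2 ^ b)%N & radon_family G.
Proof.
move=> b3; elim: a => [|a [H sH rH]].
  by have [G sG rG] := radon_family_base u b3; exists G => //;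
     rewrite sG prednK ?expn_gt0.
have rG := radon_family_tensor radon_family4 square_sign_grading
  radon_family4_grading rH.
have cT : #|{: (bool * (bool * bool * bool)) * 'I_(2 ^ (4 * a + b) * u)}|
          = (2 ^ (4 * a.+1 + b) * u)%N.
  have -> : (4 * a.+1 + b = 4 + (4 * a + b))%N by rewrite mulnS addnA.
  by rewrite !card_prod card_bool card_ord [in RHS]expnD -[RHS]mulnA.
have [G sG rG'] := radon_family_ord cT rG; exists G => //.
by rewrite sG size_cat !size_map /= mulnS addSn -addnA -sH.
Qed.

Lemma radon_family_hurwitz (n : nat) : (0 < n)%N ->
  exists2 G : seq (signed_map 'I_n),
    (size G).+1 = hurwitz_radon n & radon_family G.
Proof.
move=> n0; rewrite /hurwitz_radon.
have Dn : (2 ^ (4 * (logn 2 n %/ 4) + logn 2 n %% 4) * n`_2^')%N = n.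
  by rewrite mulnC [(4 * _)%N]mulnC -divn_eq -p_part mulnC partnC.
have b3 : (logn 2 n %% 4 <= 3)%N by rewrite -ltnS ltn_mod.
by have := radon_family_exists (logn 2 n %/ 4) (n`_2^')%N b3; rewrite Dn.
Qed.

(** * Hadamard matrices and sums of squares *)

Definition signed_mx (R : pzRingType) (n : nat) (g : signed_map 'I_n) :
    'M[R]_n :=
  \matrix_(a, b) ((-1) ^+ (g a).1 * ((g a).2 == b)%:R).

Lemma signed_mxM (R : pzRingType) (n p : nat) (g : signed_map 'I_n)
    (A : 'M[R]_(n, p)) (a : 'I_n) (c : 'I_p) :
  (signed_mx R g *m A) a c = (-1) ^+ (g a).1 * A (g a).2 c.
Proof.
rewrite mxE (bigD1 (g a).2) //= big1 ?addr0; first by rewrite mxE eqxx mulr1.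
by move=> b /negPf nb; rewrite mxE eq_sym nb mulr0 mul0r.
Qed.

(** Rows act on the left, whence the reversal of the order of composition. *)
Lemma signed_mx_comp (R : pzRingType) (n : nat) (g h : signed_map 'I_n) :
  signed_mx R g *m signed_mx R h = signed_mx R (signed_comp h g).
Proof.
by apply/matrixP=> a b; rewrite signed_mxM !mxE /= mulrA signr_addb.
Qed.

Lemma signed_mx_id (R : pzRingType) (n : nat) :
  signed_mx R (@signed_id 'I_n) = 1%:M.
Proof. by apply/matrixP=> a b; rewrite !mxE mul1r. Qed.

Lemma signed_mx_sqr (R : pzRingType) (n : nat) (g : signed_map 'I_n) :
  square_sign true g -> signed_mx R g *m signed_mx R g = - 1%:M.
Proof.
move=> /forallP sg; rewrite signed_mx_comp; apply/matrixP=> a b.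
by rewrite !mxE (eqP (sg a)) mulN1r.
Qed.

(** A signed permutation matrix is orthogonal; if moreover it squares to [-1],
    then its transpose, being its inverse, is its opposite. *)
Lemma signed_mx_tr (R : pzRingType) (n : nat) (g : signed_map 'I_n) :
  square_sign true g -> (signed_mx R g)^T = - signed_mx R g.
Proof.
move=> /forallP sg; apply/matrixP=> a b; rewrite !mxE.
have [E1 E2] := eqP (sg a); have [F1 F2] := eqP (sg b).
have -> : ((g b).2 == a) = ((g a).2 == b).
  by apply/eqP/eqP=> [<-|<-].
case: eqP => [gab|_]; last by rewrite !mulr0 oppr0.
rewrite !mulr1 -gab -signrN; congr (_ ^+ _).
by move: E1; rewrite /signed_comp /=; case: (g a).1; case: (g _).1.
Qed.

Lemma signed_mx_anticomm (R : pzRingType) (n : nat) (g h : signed_map 'I_n) :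
  commutation_sign true g h ->
  signed_mx R g *m signed_mx R h + signed_mx R h *m signed_mx R g = 0.
Proof.
move=> /forallP cgh; rewrite !signed_mx_comp; apply/matrixP=> a b.
rewrite !mxE; have [E1 E2] := eqP (cgh a).
rewrite /signed_comp /= in E1 E2 *.
by rewrite E1 E2 signrN mulNr subrr.
Qed.

(** In the expansion of [W W^T] the terms [c_l c_l' (V_l V_l'^T + V_l' V_l^T)]
    vanish for distinct [l] and [l']. *)
Lemma hurwitz_sum_of_squares (R : comPzRingType) (n : nat) (V : nat -> 'M[R]_n)
    (r : nat) (c : nat -> R) :
  (forall l, (l < r)%N -> V l *m (V l)^T = 1%:M) ->
  (forall l l', (l < l' < r)%N -> V l *m (V l')^T + V l' *m (V l)^T = 0) ->
  let W := \sum_(0 <= l < r) c l *: V l in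
  W *m W^T = (\sum_(0 <= l < r) c l ^+ 2)%:M.
Proof.
elim: r => [|r IHr] V1 VV /=.
  by rewrite !big_geq // mul0mx raddf0.
rewrite !big_nat_recr //=; set W := \sum_(0 <= l < r) _.
rewrite linearD /= mulmxDl !mulmxDr -/W.
rewrite {1}/W IHr; last 2 first.
- by move=> l lr; apply: V1; rewrite ltnS ltnW.
- by move=> l l' /andP[ll' lr]; apply: VV; rewrite ll' ltnS ltnW.
have cross : W *m (c r *: V r)^T + c r *: V r *m W^T = 0.
  rewrite /W linear_sum /= mulmx_suml mulmx_sumr -big_split /= big_nat big1 //.
  move=> l /= lr; rewrite !linearZ /= -!scalemxAl !scalerA.
  rewrite [c r * c l]mulrC -scalerDr VV ?scaler0 //.
  by rewrite lr ltnSn.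
rewrite -addrA [X in _ + X]addrA cross add0r.
rewrite !linearZ /= -!scalemxAl !scalerA V1 //.
by rewrite scalemx1 -raddfD /= expr2.
Qed.

(** [M] is the matrix [\sum_l c_l U_l H], whose products of rows are
    [n |c|^2] times those of the identity because [H H^T = n I].  The entries of
    [U_l H] are, up to sign, entries of [H] in a permuted order, so they are
    signs. *)
Lemma hurwitz_radon_hadamard (R : realType) (n r : nat) :
  hadamard_order n -> (r <= hurwitz_radon n)%N ->
  exists s : nat -> 'I_n -> 'I_n -> bool, forall (c : nat -> R) (a a' : 'I_n),
    let M a b := \sum_(0 <= l < r) (-1) ^+ s l a b * c l in
    \sum_b M a b * M a' b
      = n%:R * (\sum_(0 <= l < r) c l ^+ 2) * (a == a')%:R.
Proof.
move=> [n0 [H [Hs HH]]] rn.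
have [G sG /andP[sqG cG]] := radon_family_hurwitz n0.
pose g := nth (@signed_id _) (@signed_id _ :: G).
exists (fun l a b => (g l a).1 (+) (H (g l a).2 b == -1)) => c a a' M.
pose HR : 'M[R]_n := map_mx intr H.
have HRE i j : HR i j = (-1) ^+ (H i j == -1).
  by rewrite mxE; case: (Hs i j) => ->.
have HRHR : HR *m HR^T = n%:R%:M.
  by rewrite /HR map_trmx -map_mxM HH map_scalar_mx rmorph_nat.
pose V l := signed_mx R (g l).
pose W := \sum_(0 <= l < r) c l *: V l.
have ME i b : M i b = (W *m HR) i b.
  rewrite /W mulmx_suml summxE; apply: eq_bigr => l _.
  by rewrite -scalemxAl mxE signed_mxM HRE signr_addb mulrC.
have WW : W *m W^T = (\sum_(0 <= l < r) c l ^+ 2)%:M.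
  have sqV l : (l.+1 < r)%N -> square_sign true (g l.+1).
    move=> lr; apply: (all_nthP (@signed_id _) sqG).
    by rewrite -ltnS sG (leq_trans lr).
  apply: hurwitz_sum_of_squares => [[|l] lr|[|l] [|l'] // /andP[ll' lr]].
  - by rewrite /V signed_mx_id trmx1 mulmx1.
  - by rewrite /V signed_mx_tr ?sqV // mulmxN signed_mx_sqr ?sqV // opprK.
  - by rewrite /V signed_mx_tr ?sqV // signed_mx_id trmx1 mul1mx mulmx1 addNr.
  rewrite /V !signed_mx_tr ?sqV //; last exact: ltn_trans lr.
  rewrite !mulmxN -opprD signed_mx_anticomm ?oppr0 //.
  have l'G : (l' < size G)%N by rewrite -ltnS sG (leq_trans lr).
  by apply: (pairwiseP (@signed_id _) cG); rewrite // inE (ltn_trans _ l'G).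
transitivity ((W *m HR *m (W *m HR)^T) a a').
  by rewrite mxE; apply: eq_bigr => b _; rewrite !ME [_^T _ _]mxE.
rewrite trmx_mul mulmxA -[_ *m HR *m HR^T]mulmxA HRHR mul_mx_scalar -scalemxAl.
by rewrite WW !mxE mulr_natr mulrnAr.
Qed.

(** * Sums over dependent multi-indices *)

(** Distributivity for factors whose ranges of summation are different types: the
    ranges are embedded in their disjoint union, where the non-dependent law
    applies. *)
Lemma prod_sum_dffun (R : comPzSemiRingType) (I : finType) (T : I -> finType)
    (F : forall i, T i -> R) :
  \prod_i \sum_(t : T i) F i t
    = \sum_(f : {dffun forall i, T i}) \prod_i F i (f i).
Proof.
rewrite (reindex (@dffun_of_fprod I T)) /=; last first.
  exact/onW_bij/dffun_of_fprod_bij.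
transitivity (\sum_(t : fprod T) \prod_(i in I) [ffun u => F i u] (t i)).
  rewrite big_fprod.
  transitivity (\prod_i \sum_(u in tagged_with T i) untag 0 [ffun v => F i v] u).
    apply: eq_bigr => i _.
    apply: etrans (big_tag (fun j (t : T j) => [ffun v => F j v] t) i).
    by apply: eq_bigr => t _; rewrite ffunE.
  exact: bigA_distr_big_dep.
by apply: eq_bigr => t _; apply: eq_bigr => i _; rewrite !ffunE.
Qed.

Lemma card_dffun_ord (I : finType) (N : I -> nat) :
  #|{dffun forall i, 'I_(N i)}| = (\prod_i N i)%N.
Proof.
rewrite -(bij_eq_card (dffun_of_fprod_bij _)) card_fprod.
by apply: eq_bigr => i _; rewrite card_ord.
Qed.

(** * The lower bound, valid for every array *)

Lemma euclidean_norm_le1 (R : realType) (n : nat) (x : 'rV[R]_n) :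
  (euclidean_norm x <= 1) = (\sum_(i < n) x 0 i ^+ 2 <= 1).
Proof.
have s0 : 0 <= \sum_(i < n) x 0 i ^+ 2 by apply: sumr_ge0 => i _; exact: sqr_ge0.
by rewrite /euclidean_norm -{1}[1]sqrtr1 ler_sqrt.
Qed.

Lemma norm_entry_le1 (R : realType) (n : nat) (x : 'rV[R]_n) (i : 'I_n) :
  euclidean_norm x <= 1 -> `|x 0 i| <= 1.
Proof.
rewrite euclidean_norm_le1 => x1.
rewrite -(@expr_le1 _ 2) // real_normK ?num_real //; apply: le_trans x1.
rewrite (bigD1 i) //= lerDl; apply: sumr_ge0 => j _; exact: sqr_ge0.
Qed.

(** The supremum in [form_norm] is meaningful because a form is bounded on the
    product of the unit balls by its number of terms. *)
Lemma sign_form_le_norm (R : realType) (k : nat) (d : 'I_k -> nat)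
    (e : sign_array d) (x : forall j, 'rV[R]_(d j)) :
  (forall j, euclidean_norm (x j) <= 1) -> `|sign_form e x| <= form_norm R e.
Proof.
move=> x1; apply: ub_le_sup; last by exists x.
exists (\sum_(i : multi_index d) 1) => _ [y y1 <-].
apply: le_trans (ler_norm_sum _ _ _) _; apply: ler_sum => i _.
rewrite normrM normrX normrN1 expr1n mul1r normr_prod.
by apply: prodr_ile1 => j _; rewrite normr_ge0 norm_entry_le1.
Qed.

(** The form is evaluated at a basis vector in every variable but [j0], and in
    the variable [j0] at the vector proportional to the signs that remain. *)
Lemma sqrt_dim_le_form_norm (R : realType) (k : nat) (d : 'I_k -> nat)
    (e : sign_array d) (j0 : 'I_k) :
  (forall j, (0 < d j)%N) -> Num.sqrt (d j0)%:R <= form_norm R e.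
Proof.
move=> d0; pose o j := Ordinal (d0 j).
pose I (l : 'I_(d j0)) : multi_index d := [ffun j => eqtype.dfwith o l j].
pose c : R := (Num.sqrt (d j0)%:R)^-1.
have dc : (d j0)%:R * c = Num.sqrt (d j0)%:R.
  rewrite -{1}[(d j0)%:R]sqr_sqrtr ?ler0n // expr2 mulfK //.
  by rewrite gt_eqF // sqrtr_gt0 ltr0n.
pose x : forall j, 'rV[R]_(d j) :=
  eqtype.dfwith (fun j => \row_l (l == o j)%:R) (\row_l (entry R e (I l) * c)).
have x1 j : euclidean_norm (x j) <= 1.
  rewrite euclidean_norm_le1 /x; case: eqtype.dfwithP => [|{}j _].
    under eq_bigr => l _ do rewrite mxE exprMn /entry sqrr_sign mul1r.
    rewrite sumr_const card_ord -mulr_natl expr2 mulrA dc mulfV //.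
    by rewrite gt_eqF // sqrtr_gt0 ltr0n.
  rewrite (bigD1 (o j)) //= big1 ?mxE ?eqxx ?expr1n ?addr0 //.
  by move=> l /negPf lo; rewrite mxE lo expr0n.
apply: le_trans (sign_form_le_norm e x1); apply: le_trans (ler_norm _).
suff -> : sign_form e x = Num.sqrt (d j0)%:R by [].
(* Only the multi-indices that differ from [o] at most at [j0] contribute. *)
rewrite /sign_form (bigID (fun i : multi_index d => i == I (i j0))) /=.
rewrite [X in _ + X]big1 ?addr0; last first.
  move=> i /eqP iI; have [j ij] : exists j, i j != I (i j0) j.
    apply/existsP; apply: contra_notT iI => /existsPn ij.
    by apply/ffunP=> j; apply/eqP; rewrite -[_ == _]negbK ij.
  have jj : j0 != j.
    by apply: contraNneq ij => <-; rewrite ffunE dfwith_in.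
  rewrite (bigD1 j) //= {1}/x dfwith_out // mxE.
  by move: ij; rewrite ffunE dfwith_out // => /negPf ->; rewrite mul0r mulr0.
rewrite (reindex_onto I (fun i => i j0)) /=; last by move=> i /eqP <-.
have Ij0 l : I l j0 = l by rewrite ffunE dfwith_in.
transitivity (\sum_(l < d j0) c); last first.
  by rewrite sumr_const card_ord -[LHS]mulr_natl dc.
apply: eq_big => l; first by rewrite Ij0 !eqxx.
move=> _; rewrite (bigD1 j0) //= big1 ?mulr1; last first.
  by move=> j jj; rewrite /x ffunE !dfwith_out 1?eq_sym // mxE eqxx.
by rewrite Ij0 /x dfwith_in mxE mulrA -expr2 sqrr_sign mul1r.
Qed.

(** * The upper bound *)

(** The Cauchy-Schwarz inequality, from the expansion of
    [\sum_t (w t - s * z t)^2 >= 0] with [s = sqrt c]. *)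
Lemma norm_dot_le_sqrt (R : realType) (T : finType) (c : R) (w z : T -> R) :
  0 < c -> \sum_t w t ^+ 2 <= c -> \sum_t z t ^+ 2 <= 1 ->
  `|\sum_t w t * z t| <= Num.sqrt c.
Proof.
move=> c0 wc z1; set s := Num.sqrt c.
have s0 : 0 < s by rewrite sqrtr_gt0.
have ss : s ^+ 2 = c by rewrite sqr_sqrtr ?ltW.
suff half (z' : T -> R) : \sum_t z' t ^+ 2 <= 1 -> \sum_t w t * z' t <= s.
  rewrite ler_norml half // andbT lerNl -sumrN.
  under eq_bigr do rewrite -mulrN.
  by apply: half; under eq_bigr do rewrite sqrrN.
move=> z'1; rewrite -(ler_pM2l s0) -expr2 ss.
have sq0 : 0 <= \sum_t (w t - s * z' t) ^+ 2.
  by apply: sumr_ge0 => t _; exact: sqr_ge0.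
have sqE : \sum_t (w t - s * z' t) ^+ 2
    = \sum_t w t ^+ 2 + c * \sum_t z' t ^+ 2 - 2 * (s * \sum_t w t * z' t).
  rewrite !mulr_sumr -big_split -sumrB /=; apply: eq_bigr => t _.
  by rewrite -ss; ring.
have : c * \sum_t z' t ^+ 2 <= c * 1 by rewrite ler_pM2l.
lra.
Qed.

(** Extending row vectors by zero to all of [nat] frees the later computations
    from the dependent dimensions of the variables, which are equal to [r v],
    [m] and [n] only propositionally. *)
Definition row_ext (R : pzRingType) (n : nat) (x : 'rV[R]_n) (l : nat) : R :=
  oapp (fun i => x 0 i) 0 (insub l).

Lemma row_ext_ord (R : pzRingType) (n : nat) (x : 'rV[R]_n) (i : 'I_n) :
  row_ext x i = x 0 i.
Proof. by rewrite /row_ext valK. Qed.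

Lemma sum_row_ext (R : pzRingType) (n n' : nat) (x : 'rV[R]_n)
    (F : nat -> R -> R) :
  n = n' -> \sum_(i < n) F i (x 0 i) = \sum_(0 <= l < n') F l (row_ext x l).
Proof.
by move=> <-; rewrite big_mkord; apply: eq_bigr => i _; rewrite row_ext_ord.
Qed.

Lemma signr_big_addb (R : pzRingType) (I : finType) (b : I -> bool) :
  (-1) ^+ (\big[addb/false]_i b i) = \prod_i (-1) ^+ b i :> R.
Proof.
by apply: (big_morph (fun c : bool => (-1) ^+ c)) => // x y; rewrite signr_addb.
Qed.

Lemma nth_enum_eq (P : finType) (p0 p : P) (l : nat) : (l < #|P|)%N ->
  (nth p0 (enum P) l == p) = (l == index p (enum P)).
Proof.
move=> lP; apply/eqP/eqP => [<-|->]; last by rewrite nth_index // mem_enum.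
by rewrite index_uniq ?enum_uniq // -cardE.
Qed.

Lemma row_ext_index_pick (R : pzRingType) (P : finType) (n : nat) (x : 'rV[R]_n)
    (p : P) :
  \sum_(0 <= l < n) (l == index p (enum P))%:R * row_ext x l
    = row_ext x (index p (enum P)).
Proof.
rewrite -(sum_row_ext x (fun l y => (l == index p (enum P))%:R * y) (erefl n)).
rewrite /row_ext; case: insubP => [i _ <-|/= out].
  rewrite (bigD1 i) //= eqxx mul1r big1 ?addr0 // => j /negPf ji.
  by rewrite -val_eqE /= in ji; rewrite ji mul0r.
rewrite big1 // => j _; case: eqP => [jp|_]; last by rewrite mul0r.
by rewrite -jp ltn_ord in out.
Qed.

(** A vector indexed by ['I_n] becomes one indexed by [P], through the
    enumeration of [P], with the same Euclidean norm: the entries past [n] are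
    zero. *)
Lemma sum_row_ext_index_sqr (R : pzRingType) (P : finType) (n : nat)
    (x : 'rV[R]_n) : (n <= #|P|)%N ->
  \sum_(p : P) row_ext x (index p (enum P)) ^+ 2 = \sum_(i < n) x 0 i ^+ 2.
Proof.
move=> nP; case: n => [|n] in x nP *.
  rewrite big_ord0 big1 // => p _; rewrite /row_ext.
  by case: insubP => [[]|_ /=]; rewrite ?expr0n.
have [p0 _] : exists p0, p0 \in P by apply/card_gt0P; exact: leq_trans nP.
rewrite (sum_row_ext x (fun _ y => y ^+ 2) (erefl _)).
rewrite -big_enum (big_nth p0) -cardE (big_cat_nat (n := n.+1)) //=.
rewrite [X in _ + X]big_nat [X in _ + X]big1 ?addr0 => [|l /andP[nl lP]]; last first.
  rewrite index_uniq -?cardE ?enum_uniq // /row_ext insubN ?expr0n //.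
  by rewrite -leqNgt.
rewrite big_nat [RHS]big_nat; apply: eq_bigr => l /andP[_ ln].
by rewrite index_uniq ?enum_uniq // -cardE (leq_trans ln).
Qed.

(** If the rows of each [M v] are orthogonal with square norm [c v], those of
    the Kronecker product are orthogonal with square norm [\prod_v c v], since
    the sum over the multi-index [t] distributes over [v]. *)
Lemma tensor_orthogonal (R : comPzRingType) (I : finType) (N : I -> nat)
    (c : I -> R) (M : forall v, 'I_(N v) -> 'I_(N v) -> R)
    (p p' : {dffun forall v, 'I_(N v)}) :
  (forall v a a', \sum_b M v a b * M v a' b = c v * (a == a')%:R) ->
  \sum_(t : {dffun forall v, 'I_(N v)})
      (\prod_v M v (p v) (t v)) * (\prod_v M v (p' v) (t v))
    = (\prod_v c v) * (p == p')%:R.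
Proof.
move=> orth.
transitivity (\sum_(t : {dffun forall v, 'I_(N v)})
    \prod_v (M v (p v) (t v) * M v (p' v) (t v))).
  by apply: eq_bigr => t _; rewrite big_split.
rewrite -(prod_sum_dffun (fun v b => M v (p v) b * M v (p' v) b)).
under eq_bigr do rewrite orth.
rewrite big_split /=; congr (_ * _); case: eqP => [->|pp'].
  by rewrite big1 // => v _; rewrite eqxx.
have [v pv] : exists v, p v != p' v.
  apply/existsP; apply: contra_notT pp' => /existsPn pp'.
  by apply/ffunP=> v; apply/eqP; rewrite -[_ == _]negbK pp'.
by rewrite (bigD1 v) //= (negPf pv) mul0r.
Qed.

(** The square norm of [Y T] is [Y T T^T Y^T], and [T T^T = C I]. *)
Lemma orthogonal_image_norm (R : comPzRingType) (P : finType) (C : R)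
    (T : P -> P -> R) (Y : P -> R) :
  (forall p p', \sum_t T p t * T p' t = C * (p == p')%:R) ->
  \sum_t (\sum_p T p t * Y p) ^+ 2 = C * \sum_p Y p ^+ 2.
Proof.
move=> orth.
under eq_bigr do rewrite expr2 big_distrlr /=.
rewrite exchange_big mulr_sumr; apply: eq_bigr => p _ /=.
rewrite exchange_big (bigD1 p) //= [X in _ + X]big1 ?addr0 => [|p' pp'].
  under eq_bigr do rewrite mulrACA.
  by rewrite -mulr_suml orth eqxx mulr1 expr2.
under eq_bigr do rewrite mulrACA.
by rewrite -mulr_suml orth eq_sym (negPf pp') mulr0 mul0r.
Qed.

Lemma dims_cat2_lshift (q : nat) (r : 'I_q -> nat) (m n : nat) (v : 'I_q) :
  dims_cat2 (k := q + 2) r m n (lshift 2 v) = r v.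
Proof.
rewrite /dims_cat2 nth_cat size_codom card_ord /= ltn_ord codomE.
by rewrite (nth_map v) ?size_enum_ord // nth_ord_enum.
Qed.

Lemma dims_cat2_rshift (q : nat) (r : 'I_q -> nat) (m n : nat) (c : 'I_2) :
  dims_cat2 (k := q + 2) r m n (rshift q c) = nth 0%N [:: m; n] c.
Proof.
by rewrite /dims_cat2 nth_cat size_codom card_ord /= ltnNge leq_addr addKn.
Qed.

(** The form whose norm is estimated is
    [\sum_(p, t) (\prod_v M_v (p v) (t v)) Y p Z t] with [M_v] depending
    linearly on the variable [v].  The row and column indices [p] and [t]
    of the Kronecker product are tuples; they are matched with the last two
    coordinates of a multi-index by the enumeration of the tuples. *)
Lemma form_norm_le_sqrt (R : realType) (k q : nat) (N r : 'I_q -> nat)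
    (m : nat) :
  k = (q + 2)%N -> (forall v, hadamard_order (N v)) ->
  (forall v, r v <= hurwitz_radon (N v))%N -> (m <= \prod_v N v)%N ->
  exists e : sign_array (dims_cat2 (k := k) r m (\prod_v N v)%N),
    form_norm R e <= Num.sqrt (\prod_v N v)%N%:R.
Proof.
move=> -> hN hr hm; set n := (\prod_v N v)%N in hm *.
set d := dims_cat2 _ _ _.
pose P := {dffun forall v, 'I_(N v)}.
have cP : #|{: P}| = n by exact: card_dffun_ord.
have N0 v : (0 < N v)%N by case: (hN v).
have n0 : (0 < n)%N by exact: prodn_gt0.
have dL v : d (lshift 2 v) = r v by exact: dims_cat2_lshift.
have dm : d (rshift q ord0) = m by rewrite /d dims_cat2_rshift.
have dn : d (rshift q ord_max) = n by rewrite /d dims_cat2_rshift.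
have [s sP] := fin_all_exists (fun v => hurwitz_radon_hadamard R (hN v) (hr v)).
pose row (l : nat) : P := nth [ffun v => Ordinal (N0 v)] (enum {: P}) l.
have rowP (l : nat) (p : P) : (l < n)%N -> (row l == p) = (l == index p (enum {: P})).
  by move=> ln; apply: nth_enum_eq; rewrite cP.
pose e : sign_array d := [ffun i : multi_index d => \big[addb/false]_v
  s v (i (lshift 2 v)) (row (i (rshift q ord0)) v) (row (i (rshift q ord_max)) v)].
exists e.
(* For fixed [p] and [t] the coefficient is a product over all the variables,
   with an indicator for each of the last two, so that summing over the
   multi-indices can be done one variable at a time. *)
pose F (p t : P) (j : 'I_(q + 2)) (l : nat) : R :=
  match fintype.split j with
  | inl v => (-1) ^+ s v l (p v) (t v)
  | inr c => (l == index (if c == ord0 then p else t) (enum {: P}))%:R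
  end.
have FL p t v l : F p t (lshift 2 v) l = (-1) ^+ s v l (p v) (t v).
  by rewrite /F (unsplitK (inl v)).
have FR p t c l : F p t (rshift q c) l
    = (l == index (if c == ord0 then p else t) (enum {: P}))%:R.
  by rewrite /F (unsplitK (inr c)).
have prodF (G : 'I_(q + 2) -> R) : \prod_j G j =
    (\prod_v G (lshift 2 v)) * (G (rshift q ord0) * G (rshift q ord_max)).
  rewrite big_split_ord /= 2!big_ord_recl big_ord0 mulr1.
  by congr (_ * (_ * G (rshift _ _))); exact: val_inj.
have entryE i : entry R e i = \sum_p \sum_t \prod_j F p t j (i j).
  pose p := row (i (rshift q ord0)); pose t := row (i (rshift q ord_max)).
  have im : (i (rshift q ord0) < n)%N.
    by apply: leq_trans hm; rewrite -[X in (_ < X)%N]dm.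
  have iN : (i (rshift q ord_max) < n)%N by rewrite -[X in (_ < X)%N]dn.
  rewrite (bigD1 p) //= (bigD1 t) //= [X in _ + X + _]big1 ?addr0 => [|t' t't].
    rewrite [X in _ + X]big1 ?addr0 => [|p' p'p].
      rewrite prodF !FR /= -!rowP // !eqxx !mulr1 /entry ffunE.
      rewrite signr_big_addb.
      by apply: eq_bigr => v _; rewrite FL.
    apply: big1 => t' _; rewrite prodF !FR /= -rowP // eq_sym (negPf p'p).
    by rewrite mul0r mulr0.
  by rewrite prodF !FR /= -(rowP _ t') // [_ == t']eq_sym (negPf t't) !mulr0.
apply: ge_sup.
  exists `|sign_form e (fun=> 0)|; exists (fun=> 0) => //= j.
  by rewrite euclidean_norm_le1 big1 // => l _; rewrite mxE expr0n.
move=> _ [x x1 <-].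
have {}x1 j : \sum_(i < d j) x j 0 i ^+ 2 <= 1 by rewrite -euclidean_norm_le1.
pose c v l := row_ext (x (lshift 2 v)) l.
pose M v a b : R := \sum_(0 <= l < r v) (-1) ^+ s v l a b * c v l.
pose T (p t : P) := \prod_v M v (p v) (t v).
pose Y (p : P) := row_ext (x (rshift q ord0)) (index p (enum {: P})).
pose Z (t : P) := row_ext (x (rshift q ord_max)) (index t (enum {: P})).
have -> : sign_form e x = \sum_t (\sum_p T p t * Y p) * Z t.
  transitivity (\sum_p \sum_t \prod_j \sum_(l < d j) F p t j l * x j 0 l).
    transitivity (\sum_(i : multi_index d) \sum_p \sum_t
                    \prod_j (F p t j (i j) * x j 0 (i j))).
      apply: eq_bigr => i _; rewrite entryE mulr_suml; apply: eq_bigr => p _.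
      by rewrite mulr_suml; apply: eq_bigr => t _; rewrite big_split.
    rewrite exchange_big; apply: eq_bigr => p _ /=.
    rewrite exchange_big; apply: eq_bigr => t _ /=.
    by rewrite (prod_sum_dffun (fun j (l : 'I_(d j)) => F p t j l * x j 0 l)).
  rewrite exchange_big; apply: eq_bigr => t _; rewrite mulr_suml.
  apply: eq_bigr => p _; rewrite prodF -!mulrA; congr (_ * (_ * _)).
  - apply: eq_bigr => v _.
    rewrite (sum_row_ext _ (fun l y => F p t _ l * y) (dL v)).
    by apply: eq_bigr => l _; rewrite FL.
  - rewrite (sum_row_ext _ (fun l y => F p t _ l * y) (erefl _)).
    by under eq_bigr do rewrite FR /=; exact: row_ext_index_pick.
  - rewrite (sum_row_ext _ (fun l y => F p t _ l * y) (erefl _)).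
    by under eq_bigr do rewrite FR /=; exact: row_ext_index_pick.
apply: norm_dot_le_sqrt; first by rewrite ltr0n.
  rewrite (orthogonal_image_norm
    (C := \prod_v ((N v)%:R * \sum_(0 <= l < r v) c v l ^+ 2))); last first.
    by move=> p p'; apply: tensor_orthogonal => v a a'; exact: sP.
  rewrite sum_row_ext_index_sqr; last by rewrite cP dm.
  rewrite big_split /= -natr_prod -mulrA -[leRHS]mulr1.
  apply: ler_wpM2l; first exact: ler0n.
  have S01 v : 0 <= \sum_(0 <= l < r v) c v l ^+ 2 <= 1.
    rewrite -(sum_row_ext _ (fun _ y => y ^+ 2) (dL v)) x1 andbT.
    by apply: sumr_ge0 => l _; exact: sqr_ge0.
  apply: mulr_ile1; last exact: x1.
  - by apply: prodr_ge0 => v _; case/andP: (S01 v).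
  - by apply: sumr_ge0 => l _; exact: sqr_ge0.
  - by apply: prodr_ile1 => v _; exact: S01.
by rewrite sum_row_ext_index_sqr // cP dn.
Qed.

(** With [q] a variable, unlike [k - 2], the number [k] can be replaced by
    [q + 2], and the indices of the variables split as a disjoint union. *)
Lemma Lambda_radon (R : realType) (k q : nat) (N r : 'I_q -> nat) (m : nat) :
  k = (q + 2)%N -> (forall v, hadamard_order (N v)) ->
  (forall v, 0 < r v <= hurwitz_radon (N v))%N ->
  (1 <= m <= \prod_v N v)%N ->
  Lambda R (dims_cat2 (k := k) r m (\prod_v N v)%N)
    = Num.sqrt (\prod_v N v)%N%:R.
Proof.
move=> kq hN hr /andP[m0 mN].
have rle v : (r v <= hurwitz_radon (N v))%N by case/andP: (hr v).
have [[e0 Le0] Lmin] := Lambda_minimum R (dims_cat2 (k := k) r m (\prod_v N v)%N).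
apply/eqP; rewrite eq_le; apply/andP; split.
  have [e eN] := form_norm_le_sqrt R kq hN rle mN.
  exact: le_trans (Lmin e) eN.
rewrite {}Le0; subst k; have n0 : (0 < \prod_v N v)%N by exact: leq_trans mN.
have d0 j : (0 < dims_cat2 (k := q + 2) r m (\prod_v N v)%N j)%N.
  case: (splitP j) => [v|c] jE.
    by rewrite (_ : j = lshift 2 v) ?dims_cat2_lshift; [case/andP: (hr v)|exact: val_inj].
  rewrite (_ : j = rshift q c) ?dims_cat2_rshift; last exact: val_inj.
  by case: c {jE} => [[|[|//]] /=].
have := sqrt_dim_le_form_norm R e0 (rshift q ord_max) d0.
by rewrite dims_cat2_rshift.
Qed.

Theorem theorem7p1 (R : realType) (k : nat) (hk : (3 <= k)%N)
    (N : 'I_(k - 2) -> nat) (r : 'I_(k - 2) -> nat) (m : nat)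
    (hN : forall v : 'I_(k - 2), hadamard_order (N v))
    (hr : forall v : 'I_(k - 2), (0 < r v <= hurwitz_radon (N v))%N)
    (hm : (1 <= m <= \prod_(v < k - 2) N v)%N) :
  Lambda R (dims_cat2 (k := k) r m (\prod_(v < k - 2) N v)%N)
    = Num.sqrt (\prod_(v < k - 2) N v)%N%:R.
Proof.
by apply: (@Lambda_radon R k (k - 2)) => //; rewrite subnK // ltnW.
Qed.
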